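(* Let $k$ be any field, and let $V$ be a finitely generated FI-module over $k$. Then there exists an integer-valued polynomial $P(T)\in\mathbb{Q}[T]$ such that for all sufficiently large $n$, $\dim_k V_n=P(n)$.
   Context: Let $\mathrm{FI}$ be the category whose objects are finite sets and whose morphisms are injections; $[n]=\{1,\dots,n\}$, $[0]=\emptyset$. For a commutative ring $R$, an FI-module over $R$ is a covariant functor $V$ from $\mathrm{FI}$ to the category of $R$-modules; write $V_S=V(S)$, $V_n=V([n])$, and $f_*=V(f)$ for an injection $f$. A sub-FI-module $W\subset V$ is a collection of $R$-submodules $W_S\subset V_S$, one for each finite set $S$, with $f_*(W_S)\subset W_T$ for every injection $f\colon S\to T$. An FI-module $V$ is finitely generated if there is a finite subset of $\coprod_{n\ge 0}V_n$ that is not contained in any proper sub-FI-module of $V$. *)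

(* Defs.v *)
From HB Require Import structures.
From mathcomp Require Import all_boot all_order all_algebra.

Set Implicit Arguments.
Unset Strict Implicit.
Unset Printing Implicit Defensive.

Import GRing.Theory.
Local Open Scope ring_scope.

(* Morphisms of FI. The underlying map is a finfun, so that Leibniz equality
   of morphisms is pointwise equality of maps (see inj_homP). *)
Record inj_hom (S T : finType) := InjHom {
  inj_fun :> {ffun S -> T};
  inj_funP : injectiveb inj_fun
}.

Lemma inj_homP (S T : finType) (f g : inj_hom S T) : f =1 g -> f = g.
Proof.
case: f g => [f pf] [g pg] /= /ffunP eq_fg; case: g / eq_fg pg => pg.
by rewrite (bool_irrelevance pf pg).
Qed.

Lemma inj_id_subproof (S : finType) : injectiveb [ffun x : S => x].
Proof. by apply/injectiveP => x y; rewrite !ffunE. Qed.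

Definition inj_id (S : finType) : inj_hom S S := InjHom (inj_id_subproof S).

Lemma inj_comp_subproof (S T U : finType) (g : inj_hom T U) (f : inj_hom S T) :
  injectiveb [ffun x => g (f x)].
Proof.
apply/injectiveP => x y; rewrite !ffunE.
by move=> /(injectiveP _ (inj_funP g)) /(injectiveP _ (inj_funP f)).
Qed.

Definition inj_comp (S T U : finType) (g : inj_hom T U) (f : inj_hom S T) :
  inj_hom S U := InjHom (inj_comp_subproof g f).

Record fi_module (R : comPzRingType) := FIModule {
  fi_obj :> finType -> lmodType R;
  fi_map : forall S T : finType, inj_hom S T -> {linear fi_obj S -> fi_obj T};
  fi_map_id : forall (S : finType) (v : fi_obj S), fi_map (inj_id S) v = v;
  fi_map_comp : forall (S T U : finType) (g : inj_hom T U) (f : inj_hom S T)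
      (v : fi_obj S),
    fi_map (inj_comp g f) v = fi_map g (fi_map f v)
}.

(* Submodules are Prop-valued predicates, so they are not assumed decidable. *)
Record sub_fi_module (R : comPzRingType) (V : fi_module R) := SubFIModule {
  sub_mem :> forall S : finType, V S -> Prop;
  sub_mem0 : forall S : finType, sub_mem (0 : V S);
  sub_memD : forall (S : finType) (u v : V S),
    sub_mem u -> sub_mem v -> sub_mem (u + v);
  sub_memZ : forall (S : finType) (a : R) (v : V S),
    sub_mem v -> sub_mem (a *: v);
  sub_mem_map : forall (S T : finType) (f : inj_hom S T) (v : V S),
    sub_mem v -> sub_mem (fi_map V f v)
}.

Definition proper_sub (R : comPzRingType) (V : fi_module R)
    (W : sub_fi_module V) : Prop :=
  exists (S : finType) (v : V S), ~ W S v.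

(* The list gens is a finite subset of the disjoint union of the V_n, where
   'I_n plays the role of [n]. *)
Definition finitely_generated (R : comPzRingType) (V : fi_module R) : Prop :=
  exists gens : seq {n : nat & V 'I_n},
    forall W : sub_fi_module V, proper_sub W ->
      ~ (forall x, x \in gens -> W 'I_(tag x) (tagged x)).

(* The modules V_S are not assumed finite-dimensional: has_dim M d says that
   M has a basis of d vectors. *)
Definition has_dim (k : fieldType) (M : lmodType k) (d : nat) : Prop :=
  exists b : 'I_d -> M,
    (forall c : 'I_d -> k, \sum_(i < d) c i *: b i = 0 -> forall i, c i = 0) /\
    (forall v : M, exists c : 'I_d -> k, v = \sum_(i < d) c i *: b i).

Definition integer_valued (P : {poly rat}) : Prop :=
  forall m : int, P.[m%:~R] \is a Num.int.

(* Main.v *)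
(** Fix generators v_1, ..., v_r of V, each of them in some V_d, and assume
    that they are permuted by the symmetric groups. Every injection factors
    as a permutation followed by an increasing map, so V_n is spanned by the
    monomials f_* v_i with f : [d] -> [n] increasing. Order the monomials of
    each V_n by the generator, then lexicographically by the values of f. The
    standard monomials, those outside the span of the smaller ones, form a
    basis of V_n.

    Postcomposition with an increasing map preserves the order, so it maps
    nonstandard monomials to nonstandard ones. Encode f by the sizes
    of the d + 1 gaps in [n] that its image leaves: the nonstandard monomials
    on v_i become an up-closed subset of N^(d+1), and those in V_n become its
    points of coordinate sum n - d. By Dickson's lemma, the complement of an
    up-closed set has an eventually polynomial counting function. *)

From HB Require Import structures.
Require Import Defs.
From mathcomp Require Import all_boot all_order all_algebra.
From mathcomp Require Import boolp zify ring.

Set Implicit Arguments.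
Unset Strict Implicit.
Unset Printing Implicit Defensive.

Import Order.TTheory GRing.Theory Num.Theory.
Local Open Scope ring_scope.

(** * Integer-valued polynomials *)

Definition eventually_polynomial (f : nat -> nat) : Prop :=
  exists P : {poly rat}, integer_valued P /\
    exists N : nat, forall n, (N <= n)%N -> (f n)%:R = P.[n%:R].

Lemma ev_poly_eq (f g : nat -> nat) (N : nat) :
  (forall n, (N <= n)%N -> f n = g n) ->
  eventually_polynomial f -> eventually_polynomial g.
Proof.
move=> fg [P [intP [M fP]]]; exists P; split=> //; exists (maxn N M) => n.
by rewrite geq_max => /andP[Nn Mn]; rewrite -fg // fP.
Qed.

Lemma ev_poly_const (c : nat) : eventually_polynomial (fun=> c).
Proof.
exists c%:R%:P; split; last by exists 0 => n _; rewrite hornerC.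
by move=> m; rewrite hornerC rpred_nat.
Qed.

Lemma ev_polyD (f g : nat -> nat) :
  eventually_polynomial f -> eventually_polynomial g ->
  eventually_polynomial (fun n => f n + g n)%N.
Proof.
move=> [P [intP [M fP]]] [Q [intQ [N gQ]]]; exists (P + Q); split.
  by move=> m; rewrite hornerD rpredD.
exists (maxn M N) => n; rewrite geq_max => /andP[Mn Nn].
by rewrite hornerD natrD fP // gQ.
Qed.

Lemma ev_poly_sum (f : nat -> nat -> nat) (m : nat) :
  (forall i, eventually_polynomial (f i)) ->
  eventually_polynomial (fun n => \sum_(i < m) f i n)%N.
Proof.
move=> fP; elim: m => [|m IHm].
  by apply: (@ev_poly_eq _ _ 0) (ev_poly_const 0) => n _; rewrite big_ord0.
apply: (@ev_poly_eq _ _ 0) (ev_polyD IHm (fP m)) => n _.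
by rewrite big_ord_recr.
Qed.

Lemma ev_poly_sub (f : nat -> nat) (m : nat) :
  eventually_polynomial f -> eventually_polynomial (fun n => f (n - m)%N).
Proof.
move=> [P [intP [N fP]]]; exists (P \Po ('X - m%:R%:P)); split.
  move=> i; rewrite horner_comp hornerD hornerN hornerC hornerX.
  by rewrite (_ : _ - _ = (i - m%:Z)%:~R) //; rewrite rmorphB.
exists (N + m)%N => n leNn.
rewrite horner_comp hornerD hornerN hornerC hornerX -natrB; last by lia.
by rewrite fP //; lia.
Qed.

(** The difference [('X + 1) ^+ n.+1 - 'X ^+ n.+1] has degree [n] and leading coefficient [n.+1], so
    over the rationals a multiple of it cancels the top coefficient of [P]. *)
Lemma exists_antidifference (P : {poly rat}) :
  exists Q : {poly rat}, Q \Po ('X + 1) - Q = P.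
Proof.
elim: (size P) {-2}P (leqnn (size P)) => {P} [|n IHn] P szP.
  exists 0; rewrite comp_poly0 subr0.
  by apply/esym/eqP; rewrite -size_poly_leq0.
pose c := P`_n / n.+1%:R; pose D := ('X + 1) ^+ n.+1 - 'X ^+ n.+1 : {poly rat}.
have coefD i : D`_i = 'C(n.+1, i)%:R - (i == n.+1)%:R.
  rewrite coefB coefXn exprD1n coef_sum; congr (_ - _).
  rewrite (eq_bigr (fun j : 'I__ => (i == j)%:R *+ 'C(n.+1, j))); last first.
    by move=> j _; rewrite coefMn coefXn.
  have [lt_in|le_ni] := ltnP i n.+2.
    rewrite (bigD1 (Ordinal lt_in)) //= eqxx big1 ?addr0 // => j nj.
    by rewrite -val_eqE eq_sym in nj; rewrite (negPf nj) mul0rn.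
  rewrite bin_small // big1 // => j _.
  by rewrite gtn_eqF ?mul0rn // (leq_trans (ltn_ord j)).
have [|Q defQ] := IHn (P - c *: D).
  apply/leq_sizeP => i; rewrite leq_eqVlt => /predU1P[<-|lt_ni].
    rewrite coefB coefZ coefD binSn ltn_eqF // subr0 divfK ?subrr //.
    by rewrite pnatr_eq0.
  rewrite coefB coefZ coefD nth_default ?(leq_trans szP) //.
  by move: lt_ni; rewrite leq_eqVlt => /predU1P[<-|lt_ni];
     rewrite ?binn ?bin_small ?eqxx ?gtn_eqF // subrr mulr0 subr0.
exists (Q + c *: 'X^(n.+1)); rewrite comp_polyD comp_polyZ comp_Xn_poly.
by rewrite opprD addrACA defQ -scalerBr subrK.
Qed.

(** Past the threshold [N] the sums telescope along an antidifference [Q]; a constant added to [Q]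
    accounts for the first [N] terms. *)
Lemma ev_poly_psum (f : nat -> nat) :
  eventually_polynomial f ->
  eventually_polynomial (fun n => \sum_(i < n) f i)%N.
Proof.
move=> [P [intP [N fP]]]; have [Q defQ] := exists_antidifference P.
have QS x : Q.[x + 1] = Q.[x] + P.[x].
  rewrite -defQ [RHS]addrC hornerD hornerN horner_comp.
  by rewrite hornerD hornerX hornerC subrK.
pose S n := (\sum_(i < n) f i)%N.
have SE n : (S (N + n)%N)%:R = (S N)%:R + (Q.[(N + n)%:R] - Q.[N%:R]).
  elim: n => [|n IHn]; first by rewrite addn0; ring.
  rewrite addnS {1}/S big_ord_recr natrD -/(S _) IHn fP ?leq_addr //=.
  by rewrite -[in RHS]natr1 QS; ring.
exists (Q + ((S N)%:R - Q.[N%:R])%:P); split; last first.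
  exists N => n leNn; rewrite -/(S n) -(subnKC leNn) SE hornerD hornerC.
  by rewrite addrCA.
(* [Q] itself need not take integer values, but its differences do: up to sign they are sums of
   values of [P]. *)
have QN (n : nat) : Q.[n%:R] - Q.[0] \is a Num.int.
  elim: n => [|n IHn]; first by rewrite subrr.
  by rewrite -addn1 natrD QS addrAC rpredD // (intP n).
have Qint (m : int) : Q.[m%:~R] - Q.[0] \is a Num.int.
  case: m => n; first exact: QN.
  rewrite NegzE; elim: n => [|n IHn].
    have := QS (-1); rewrite addNr => ->.
    by rewrite opprD addrA subrr add0r rpredN (intP (-1)).
  have e : (- n.+1%:Z)%:~R = (- n.+2%:Z)%:~R + 1 :> rat.
    by rewrite -[1]/(1%:~R) -rmorphD; congr (_%:~R); lia.
  move: IHn; rewrite e QS addrAC => h.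
  by have := rpredB h (intP (- n.+2%:Z)); rewrite addrK.
move=> m; rewrite hornerD hornerC addrCA rpredD ?rpred_nat //.
rewrite -(subrK Q.[0] Q.[_]) -addrA; rewrite rpredD // -opprB rpredN.
exact: QN.
Qed.

(** * Counting the complement of an up-closed set *)

(** The weak compositions of [n] into [r] parts: the points of N^r with coordinate sum [n]. *)
Fixpoint compositions (r n : nat) : seq (seq nat) :=
  if r is r'.+1 then
    [seq j :: a | j <- iota 0 n.+1, a <- compositions r' (n - j)]
  else nseq (n == 0) [::].

Lemma mem_compositions (r n : nat) (a : seq nat) :
  (a \in compositions r n) = (size a == r) && (sumn a == n).
Proof.
elim: r n a => [|r IHr] n a.
  by rewrite mem_nseq; case: a => [|x a] /=; case: n.
apply/allpairsPdep/idP => [[j [b []]]|].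
  rewrite mem_iota IHr /= => lt_jn /andP[/eqP <- /eqP sb] -> /=.
  by rewrite sb eqxx /=; lia.
case: a => [//|x a] /andP[/eqP[sa] /eqP /= sn]; exists x, a.
by rewrite (mem_iota 0 n.+1) IHr sa eqxx -sn; split=> //; lia.
Qed.

Lemma compositions_uniq (r n : nat) : uniq (compositions r n).
Proof.
elim: r n => [|r IHr] n; first by rewrite /=; case: (n == 0).
apply: allpairs_uniq_dep => [|j _|[x a] [y b] _ _ /= [-> ->]] //.
exact: iota_uniq.
Qed.

Arguments compositions : simpl never.

Lemma sumn_incr_nth (a : seq nat) (j : nat) : sumn (incr_nth a j) = (sumn a).+1.
Proof.
elim: a j => [|x a IHa] [|j] //=; last by rewrite IHa addnS.
by elim: j.
Qed.

(** Unit steps generate the product order on lists of a given length; for [j] beyond the end,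
    [incr_nth] would lengthen the list. *)
Definition upward_closed (U : pred (seq nat)) : Prop :=
  forall a j, (j < size a)%N -> U a -> U (incr_nth a j).

Definition slice (U : pred (seq nat)) (j : nat) : pred (seq nat) :=
  fun a => U (j :: a).

Lemma slice_closed (U : pred (seq nat)) (j : nat) :
  upward_closed U -> upward_closed (slice U j).
Proof. by move=> UU a i lt_ia; apply: (UU (j :: a) i.+1). Qed.

Lemma slice_incr (U : pred (seq nat)) (i j : nat) (a : seq nat) :
  upward_closed U -> (i <= j)%N -> slice U i a -> slice U j a.
Proof.
move=> UU /subnKC <-; elim: (j - i)%N => [|m IHm]; rewrite ?addn0 // => Ui.
by rewrite addnS; apply: (UU (_ :: a) 0) => //; apply: IHm.
Qed.

Lemma incr_chain_le (U : nat -> pred (seq nat)) (m n : nat) (a : seq nat) :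
  (forall m a, U m a -> U m.+1 a) -> (m <= n)%N -> U m a -> U n a.
Proof.
move=> Uincr /subnKC <- Um; elim: (n - m)%N => [|i IHi]; rewrite ?addn0 //.
by rewrite addnS; apply: Uincr.
Qed.

(* Dickson's lemma, as an ascending chain condition. *)
Lemma upward_closed_acc (r : nat) (U : nat -> pred (seq nat)) :
  (forall m, upward_closed (U m)) ->
  (forall m a, U m a -> U m.+1 a) ->
  exists M, forall m a, (M <= m)%N -> size a = r -> U m a = U M a.
Proof.
elim: r U => [|r IHr] U UU Uincr.
  have [[M UM]|nU] := pselect (exists M, U M [::]).
    by exists M => m a Mm /size0nil ->; rewrite UM (incr_chain_le Uincr Mm UM).
  exists 0 => m a _ /size0nil ->.
  by apply/idP/idP => Um; case: nU; eexists; apply: Um.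
(* The diagonal slices ascend, since raising the index and raising the first coordinate both enlarge
   them. They are constant from [D] on. *)
have [|m a Um|D DP] := IHr (fun m => slice (U m) m).
- by move=> m; apply: slice_closed.
- by apply: (slice_incr (UU m.+1) (leqnSn m)); apply: Uincr.
(* Each of the finitely many first coordinates below [D] has its own chain of slices; a single [E]
   serves them all. *)
have [E EP] : exists E, forall j m a, (j < D)%N -> (E <= m)%N -> size a = r ->
    slice (U m) j a = slice (U E) j a.
  elim: {1}D => [|B [E EP]]; first by exists 0.
  have [||F FP] := IHr (fun m => slice (U m) B).
  - by move=> m; apply: slice_closed.
  - by move=> m a; apply: Uincr.
  exists (maxn E F) => j m a.
  rewrite ltnS leq_eqVlt geq_max => jB /andP[Em Fm] sa.
  case/predU1P: jB => [->|jB]; first by rewrite FP // [RHS]FP // leq_maxr.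
  by rewrite EP // [RHS]EP // leq_maxl.
exists (maxn D E) => m [|j a] //; rewrite geq_max => /andP[Dm Em] [sa].
have [ltjD|leDj] := ltnP j D.
  have UE n : (E <= n)%N -> U n (j :: a) = U E (j :: a) by move=> En; apply: EP.
  by rewrite !UE // leq_maxr.
(* For [j >= D], the slice of [U n] at [j] lies between the diagonal slices at [D] and at
   [maxn j n], which agree. *)
have stab n : (D <= n)%N -> U n (j :: a) = slice (U D) D a.
  move=> Dn; apply/idP/idP => [Un|UD].
    rewrite -(DP (maxn j n)) ?leq_max ?leDj //.
    apply: (slice_incr _ (leq_maxl j n)) => //.
    by apply: (incr_chain_le Uincr (leq_maxr j n)).
  by apply: (incr_chain_le Uincr Dn); apply: (slice_incr _ leDj).
by rewrite !stab // leq_maxl.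
Qed.

Lemma count_allpairs_cons (U : pred (seq nat)) (f : nat -> seq (seq nat))
    (s : seq nat) :
  count U [seq j :: a | j <- s, a <- f j]
    = (\sum_(j <- s) count (slice U j) (f j))%N.
Proof.
elim: s => [|j s IHs] /=; first by rewrite big_nil.
by rewrite big_cons count_cat IHs count_map.
Qed.

(** Split by the first coordinate [j]. The slices ascend with [j], so they stabilise at some [M]:
    all [j >= M] together give a partial sum of one eventually polynomial function, and each [j < M]
    gives a shift of another. *)
Lemma ev_poly_count_compositions (r : nat) (U : pred (seq nat)) :
  upward_closed U ->
  eventually_polynomial (fun n => count (predC U) (compositions r n)).
Proof.
elim: r U => [|r IHr] U UU.
  (* The empty list is counted at most for [n = 0], hence the threshold 1. *)
  by apply: (@ev_poly_eq _ _ 1) (ev_poly_const 0) => -[].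
have [||M MP] := @upward_closed_acc r (slice U).
- by move=> m; apply: slice_closed.
- by move=> m a; apply: slice_incr.
pose c j n := count (predC (slice U j)) (compositions r n).
have cP j : eventually_polynomial (c j) by apply/IHr/slice_closed.
have cMP : eventually_polynomial (fun n => \sum_(i < n.+1) c M i)%N.
  apply: (@ev_poly_eq _ _ 0) (ev_polyD (ev_poly_psum (cP M)) (cP M)) => n _.
  by rewrite big_ord_recr.
have cjP j := ev_poly_sub j (cP j).
apply: (@ev_poly_eq _ _ M) (ev_polyD (ev_poly_sum M cjP) (ev_poly_sub M cMP)).
move=> n leMn.
have -> : count (predC U) (compositions r.+1 n)
    = (\sum_(0 <= j < n.+1) c j (n - j))%N by exact: count_allpairs_cons.
rewrite -(big_mkord xpredT (fun j => c j (n - j)%N)).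
rewrite [RHS](@big_cat_nat _ _ _ M) //=; last by lia.
congr (_ + _)%N; rewrite -[M in RHS]add0n big_addn subSn // big_mkord.
rewrite [RHS](reindex_inj rev_ord_inj) /=; apply: eq_bigr => i _.
have le_in : (i <= n - M)%N by rewrite -ltnS.
rewrite /c (_ : n - (n - M - i + M) = i)%N; last by lia.
apply: eq_in_count => a; rewrite mem_compositions => /andP[/eqP sa _] /=.
by rewrite MP ?leq_addl.
Qed.

(** * Greedy bases *)

Section Span.
Variables (k : fieldType) (M : lmodType k).
Implicit Types (s t : seq M) (u v : M).

(** Coefficients are indexed by [nat], so that one family fits lists of different lengths, as in
    [free_rcons]. *)
Definition span s v : Prop :=
  exists c : nat -> k, v = \sum_(i < size s) c i *: s`_i.

Definition free s : Prop :=
  forall c : nat -> k, \sum_(i < size s) c i *: s`_i = 0 ->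
    forall i, (i < size s)%N -> c i = 0.

Lemma span0 s : span s 0.
Proof. by exists (fun=> 0); rewrite big1 // => i _; rewrite scale0r. Qed.

Lemma spanD s u v : span s u -> span s v -> span s (u + v).
Proof.
move=> [b ->] [c ->]; exists (fun i => b i + c i); rewrite -big_split.
by apply: eq_bigr => i _; rewrite scalerDl.
Qed.

Lemma spanZ s a v : span s v -> span s (a *: v).
Proof.
move=> [c ->]; exists (fun i => a * c i); rewrite scaler_sumr.
by apply: eq_bigr => i _; rewrite scalerA.
Qed.

Lemma mem_span s (x : M) : x \in s -> span s x.
Proof.
move=> sx; have lt_xs : (index x s < size s)%N by rewrite index_mem.
exists (fun i => (i == index x s)%:R); rewrite (bigD1 (Ordinal lt_xs)) //=.
rewrite eqxx scale1r nth_index // big1 ?addr0 // => i.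
by rewrite -val_eqE /= => /negPf ->; rewrite scale0r.
Qed.

Lemma span_ind s (P : M -> Prop) :
  P 0 -> (forall u v, P u -> P v -> P (u + v)) ->
  (forall a v, P v -> P (a *: v)) -> {in s, forall x, P x} ->
  forall v, span s v -> P v.
Proof.
move=> P0 PD PZ Ps v [c ->]; elim/big_ind: _ => // i _.
exact/PZ/Ps/mem_nth.
Qed.

Lemma sub_span s t :
  {in s, forall x, span t x} -> forall v, span s v -> span t v.
Proof. by apply: span_ind => *; [apply: span0|apply: spanD|apply: spanZ]. Qed.

Lemma span_subset s t v : {subset s <= t} -> span s v -> span t v.
Proof. by move=> st; apply: sub_span => x /st /mem_span. Qed.

Lemma span_cat s s' t t' v :
  {in s, forall x, span t x} -> {in s', forall x, span t' x} ->
  span (s ++ s') v -> span (t ++ t') v.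
Proof.
move=> st st'; apply: sub_span => x; rewrite mem_cat => /orP[/st|/st'].
  by apply: span_subset => y ty; rewrite mem_cat ty.
by apply: span_subset => y ty; rewrite mem_cat ty orbT.
Qed.

Lemma free_rcons s (x : M) : free s -> ~ span s x -> free (rcons s x).
Proof.
move=> s_free s'x c; rewrite size_rcons big_ord_recr /= nth_rcons ltnn eqxx.
rewrite (eq_bigr (fun i : 'I_(size s) => c i *: s`_i)) => [|i _]; last first.
  by rewrite nth_rcons ltn_ord.
have [c0|c_neq0] := eqVneq (c (size s)) 0.
  rewrite c0 scale0r addr0 => /s_free cs i; rewrite ltnS leq_eqVlt.
  by case/predU1P => [-> //|/cs].
move/eqP; rewrite addrC addr_eq0 => /eqP cx; case: s'x.
rewrite -[x](scalerK c_neq0) cx; apply/spanZ.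
by rewrite -scaleN1r; apply: spanZ; exists c.
Qed.

(** A kept element lies outside the span of everything before it, kept or not, so freeness persists;
    a dropped one is, by induction, in the span of [b] and the elements kept so far. *)
Lemma greedy_basis (T : eqType) (m : T -> M) (std : pred T) (b : seq M)
    (s : seq T) :
  free b ->
  (forall (s1 : seq T) (x : T) (s2 : seq T), s = s1 ++ x :: s2 ->
     std x = ~~ `[< span (b ++ map m s1) (m x) >]) ->
  free (b ++ map m (filter std s)) /\
  forall v, span (b ++ map m s) v -> span (b ++ map m (filter std s)) v.
Proof.
move=> b_free; elim/last_ind: s => [|s x IHs] stdP; first by rewrite cats0.
have [|s_free s_span] := IHs.
  by move=> s1 y s2 es; apply: (stdP _ _ (rcons s2 x)); rewrite es rcons_cat.
have := stdP s x [::]; rewrite cats1 => /(_ erefl).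
rewrite filter_rcons; case: (std x) => /esym.
  move/asboolPn => s'x; rewrite !map_rcons -!rcons_cat; split.
    apply: free_rcons => // sx; apply: s'x.
    apply: span_subset sx => y; rewrite !mem_cat => /orP[-> //|/mapP[z]].
    by rewrite mem_filter => /andP[_ sz] ->; rewrite map_f ?orbT.
  apply: sub_span => y; rewrite mem_rcons inE => /predU1P[->|sy].
    by apply: mem_span; rewrite mem_rcons mem_head.
  have /s_span : span (b ++ map m s) y by apply: mem_span.
  by apply: span_subset => z sz; rewrite mem_rcons inE sz orbT.
move/negbFE/asboolP => sx; split=> //; rewrite map_rcons -rcons_cat.
apply: sub_span => y; rewrite mem_rcons inE => /predU1P[->|sy]; apply: s_span.
  exact: sx.
exact: mem_span.
Qed.

(** Turns the prefixes in [greedy_basis] into the sets of smaller words in [smaller_monomials]. *)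
Lemma filter_lt_prefix (T : eqType) (lt : rel T) (s1 s2 : seq T) (x : T) :
  transitive lt -> irreflexive lt -> sorted lt (s1 ++ x :: s2) ->
  [seq y <- s1 ++ x :: s2 | lt y x] = s1.
Proof.
move=> tr irr; rewrite sorted_pairwise // pairwise_cat allrel_consr /=.
move=> /and3P[/andP[s1x _] _ /andP[xs2 _]]; rewrite filter_cat /= irr.
rewrite (all_filterP s1x) -[RHS]cats0; congr (_ ++ _).
apply/eqP; rewrite -(negbK (_ == _)) -has_filter.
apply/hasPn => y /(allP xs2) xy.
by apply/negP => /(tr _ _ _ xy); rewrite irr.
Qed.

Lemma has_dim_free s :
  free s -> (forall v, span s v) -> has_dim M (size s).
Proof.
move=> s_free s_span; exists (fun i => s`_i); split=> [c c0 i|v]; last first.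
  by have [c ->] := s_span v; exists c.
(* Coefficients on ['I_(size s)] are extended by 0 to [nat], as [free] expects. *)
pose c' j := if insub j is Some j' then c j' else 0.
have c'E (j : 'I_(size s)) : c' j = c j by rewrite /c' valK.
rewrite -c'E; apply: s_free => //.
by rewrite -[RHS]c0; apply: eq_bigr => j _; rewrite c'E.
Qed.

End Span.

Lemma span_linear (k : fieldType) (M N : lmodType k) (f : {linear M -> N})
    (s : seq M) (t : seq N) :
  {in s, forall v, span t (f v)} -> forall v, span s v -> span t (f v).
Proof.
move=> st; apply: span_ind => // [|u v su sv|a v sv].
- by rewrite linear0; apply: span0.
- by rewrite linearD; apply: spanD.
- by rewrite linearZ; apply: spanZ.
Qed.

(** * Increasing words *)

(* The successive values, counted from h, of the increasing map with gap sizes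
   a. The last gap comes after all values, so the last entry is not a value of
   the map but the size of its codomain. *)
Fixpoint positions (h : nat) (a : seq nat) : seq nat :=
  if a is x :: a' then (h + x)%N :: positions (h + x).+1 a' else [::].

Lemma size_positions h a : size (positions h a) = size a.
Proof. by elim: a h => //= x a IHa h; rewrite IHa. Qed.

Lemma path_positions l h a : (l < h)%N -> path ltn l (positions h a).
Proof.
by elim: a l h => //= x a IHa l h lt_lh; rewrite ltn_addr //= IHa.
Qed.

(** Computes the sentinel: for the gap list [h :: a], the total of the gaps plus the [size a] values
    of the map. *)
Lemma last_positions h a :
  last h (positions h.+1 a) = (h + sumn a + size a)%N.
Proof. by elim: a h => [|x a IHa] h /=; rewrite ?IHa; lia. Qed.

Lemma positions_inj h : injective (positions h).
Proof.
move=> a; elim: a h => [|x a IHa] h [|y b] //= [/addnI ->].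
by move=> /IHa ->.
Qed.

Lemma path_positionsP h p : path ltn h p -> exists a, p = positions h.+1 a.
Proof.
elim: p h => [|x p IHp] h /=; first by exists [::].
by move=> /andP[lt_hx /IHp[a ->]]; exists (x - h.+1 :: a)%N; rewrite /= subnKC.
Qed.

Lemma map_bump_positions l h a :
  (l <= h)%N -> map (bump l) (positions h a) = positions h.+1 a.
Proof.
elim: a h => //= x a IHa h le_lh; have le_lhx := leq_trans le_lh (leq_addr x h).
by rewrite /bump le_lhx IHa ?(leqW le_lhx).
Qed.

(** Enlarging gap [j] adds one to the entries from index [j] on; as the entries strictly increase,
    these are exactly the ones that [bump] moves. A unit step on gaps is thus a postcomposition with
    an increasing map. *)
Lemma positions_incr_nth h a j : (j < size a)%N ->
  positions h (incr_nth a j)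
    = map (bump (nth 0%N (positions h a) j)) (positions h a).
Proof.
elim: a h j => //= x a IHa h [_|j lt_ja] /=.
  by rewrite {1}/bump leqnn addnS add1n map_bump_positions.
rewrite IHa // /bump leqNgt; congr (_ :: _).
suff -> : (h + x < nth 0 (positions (h + x).+1 a) j)%N by [].
have /(order_path_min ltn_trans)/allP := path_positions a (ltnSn (h + x)%N).
by apply; rewrite mem_nth ?size_positions.
Qed.

(* The increasing maps [d] -> [n], each followed by the sentinel n. *)
Definition words (d n : nat) : seq (seq nat) :=
  if (d <= n)%N then map (positions 0) (compositions d.+1 (n - d)) else [::].

Lemma mem_words d n p :
  (p \in words d n) = [&& size p == d.+1, sorted ltn p & last 0%N p == n].
Proof.
rewrite /words; apply/idP/and3P => [|[]].
  case: ifP => // le_dn /mapP[a]; rewrite mem_compositions.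
  case: a => [//|x a] /andP[/= /eqP[sa] /eqP suma] -> /=.
  rewrite add0n size_positions sa path_positions // last_positions; split=> //.
  by apply/eqP; lia.
case: p => [//|x p] /eqP[sp] /= /path_positionsP[a def_p].
rewrite def_p last_positions => /eqP last_p.
rewrite def_p size_positions in sp.
have -> : (d <= n)%N by lia.
apply/mapP; exists (x :: a) => //; rewrite mem_compositions /= sp eqxx /=.
by apply/eqP; lia.
Qed.

Lemma words_uniq d n : uniq (words d n).
Proof.
rewrite /words; case: ifP => // _.
by rewrite (map_inj_uniq (@positions_inj 0)) compositions_uniq.
Qed.

Definition lexlt (p q : seq nat) : bool := ((p : seqlexi nat) < q)%O.

Lemma lexlt_map (f : nat -> nat) (p q : seq nat) :
  {mono f : i j / (i <= j)%N} -> lexlt p q -> lexlt (map f p) (map f q).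
Proof.
move=> fM; rewrite /lexlt; elim: p q => [|x p IHp] [|y q] //.
rewrite /= !ltxi_cons !leEnat !fM => /andP[-> /=] /implyP pq.
by apply/implyP => /pq; apply: IHp.
Qed.

(** * Monomials in an FI-module *)

HB.instance Definition _ (S T : finType) := [isSub for @inj_fun S T].
HB.instance Definition _ (S T : finType) := [Countable of inj_hom S T by <:].
HB.instance Definition _ (S T : finType) := [Finite of inj_hom S T by <:].

Lemma inj_hom_inj (S T : finType) (f : inj_hom S T) : injective f.
Proof. exact: (injectiveP _ (inj_funP f)). Qed.

Lemma exists_inj_hom (S T : finType) (f : S -> T) :
  injective f -> exists F : inj_hom S T, F =1 f.
Proof.
move=> f_inj; have inj_f : injectiveb (finfun f).
  by apply/injectiveP => x y; rewrite !ffunE => /f_inj.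
by exists (InjHom inj_f) => x; rewrite ffunE.
Qed.

Section Monomials.
Variables (k : fieldType) (V : fi_module k).
Notation element := {n : nat & V 'I_n}.
Implicit Types (x : element) (gens : seq element) (p q : seq nat).

(* Junk value 0 when p does not list the values of an injection. *)
Definition monomial n x (p : seq nat) : V 'I_n :=
  if [pick F : inj_hom 'I_(tag x) 'I_n | [forall i, val (F i) == nth 0%N p i]]
    is Some F then fi_map V F (tagged x) else 0.

Lemma monomialE n x p (F : inj_hom 'I_(tag x) 'I_n) :
  (forall i, val (F i) = nth 0%N p i) -> monomial n x p = fi_map V F (tagged x).
Proof.
move=> Fp; rewrite /monomial; case: pickP => [G /forallP Gp|/(_ F)/forallP[]i].
  rewrite (_ : G = F) //; apply: inj_homP => i; apply: val_inj.
  by rewrite Fp (eqP (Gp i)).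
by apply/eqP.
Qed.

Lemma word_inj_hom (d n : nat) p : p \in words d n ->
  exists F : inj_hom 'I_d 'I_n, forall i, val (F i) = nth 0%N p i.
Proof.
rewrite mem_words => /and3P[/eqP sp p_sorted /eqP p_last].
have lt_pn (i : 'I_d) : (nth 0%N p i < n)%N.
  rewrite -p_last -nth_last sp /=.
  by apply: (sorted_ltn_nth ltn_trans) => //; rewrite inE sp //= ltnS ltnW.
have [|F FE] := @exists_inj_hom _ _ (fun i => Ordinal (lt_pn i)).
  move=> i j [/eqP]; rewrite nth_uniq ?sp ?ltnS 1?ltnW //.
    by move=> /eqP/val_inj.
  exact: sorted_uniq ltn_trans ltnn _ p_sorted.
by exists F => i; rewrite FE.
Qed.

Definition monomials x n : seq (V 'I_n) := map (monomial n x) (words (tag x) n).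

Definition all_monomials gens n : seq (V 'I_n) :=
  flatten [seq monomials x n | x <- gens].

Lemma exists_lift_hom n h : (h <= n)%N ->
  exists G : inj_hom 'I_n 'I_n.+1, forall i, val (G i) = bump h i.
Proof.
rewrite -ltnS => lt_hn.
have [G GE] := exists_inj_hom (@lift_inj _ (Ordinal lt_hn)).
by exists G => i; rewrite GE.
Qed.

(** The sentinel stays correct because [h <= n] gives [bump h n = n.+1]. *)
Lemma map_bump_words d n h p : (h <= n)%N ->
  p \in words d n -> map (bump h) p \in words d n.+1.
Proof.
move=> le_hn; rewrite !mem_words size_map.
move=> /and3P[/eqP sp p_sorted /eqP p_last].
have bump_lt i j : (i < j)%N -> (bump h i < bump h j)%N.
  by rewrite !ltnNge leq_bump2.
rewrite sp eqxx (homo_sorted bump_lt _ p_sorted) /=.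
case: p sp p_last {p_sorted} => //= y p _ p_last.
by rewrite last_map p_last /bump le_hn.
Qed.

Lemma fi_map_monomial n x h p (G : inj_hom 'I_n 'I_n.+1) :
  (forall i, val (G i) = bump h i) -> p \in words (tag x) n ->
  fi_map V G (monomial n x p) = monomial n.+1 x (map (bump h) p).
Proof.
move=> Gh p_word; have [F Fp] := word_inj_hom p_word.
rewrite (monomialE Fp) (@monomialE _ _ _ (Defs.inj_comp G F)).
  by rewrite fi_map_comp.
move=> i.
move: p_word; rewrite mem_words => /and3P[/eqP sp _ _].
by rewrite ffunE Gh Fp (nth_map 0%N) // sp ltnW // ltnS.
Qed.

Lemma lift_all_monomials gens n h (G : inj_hom 'I_n 'I_n.+1) :
  (forall i, val (G i) = bump h i) -> (h <= n)%N ->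
  forall v, span (all_monomials gens n) v ->
    span (all_monomials gens n.+1) (fi_map V G v).
Proof.
move=> Gh le_hn; apply: span_linear => v /flatten_mapP[x gx /mapP[p wp ->]].
rewrite (fi_map_monomial Gh wp); apply/mem_span/flatten_mapP; exists x => //.
exact/map_f/map_bump_words.
Qed.

(** Here [gens] are the generators preceding [x], so all their monomials count as smaller. *)
Definition smaller_monomials gens x n p : seq (V 'I_n) :=
  all_monomials gens n
    ++ [seq monomial n x q | q <- words (tag x) n & lexlt q p].

Definition nonstandard gens x n p : bool :=
  `[< span (smaller_monomials gens x n p) (monomial n x p) >].

(** Apply the linear map induced by the injection that skips [h] to a linear relation: it sends
    smaller monomials to smaller ones. *)
Lemma nonstandard_bump gens x n h p : (h <= n)%N -> p \in words (tag x) n ->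
  nonstandard gens x n p -> nonstandard gens x n.+1 (map (bump h) p).
Proof.
move=> le_hn p_word /asboolP p_span; apply/asboolP.
have [G Gh] := exists_lift_hom le_hn; rewrite -(fi_map_monomial Gh p_word).
apply: span_linear p_span => v; rewrite mem_cat => /orP[gv|/mapP[q]].
  have := lift_all_monomials (gens := gens) Gh le_hn (mem_span gv).
  by apply: span_subset => u gu; rewrite mem_cat gu.
rewrite mem_filter => /andP[lt_qp q_word] ->; apply: mem_span.
rewrite (fi_map_monomial Gh q_word) mem_cat map_f ?orbT // mem_filter.
rewrite map_bump_words // andbT.
by apply: lexlt_map lt_qp => i j; rewrite leq_bump2.
Qed.

Lemma ev_poly_count_standard gens x :
  eventually_polynomial
    (fun n => count (predC (nonstandard gens x n)) (words (tag x) n)).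
Proof.
set d := tag x.
(* A gap list determines its codomain size, [sumn a + d], so a single set [U] covers all [n] at
   once. *)
pose U a := (size a == d.+1) && nonstandard gens x (sumn a + d) (positions 0 a).
have UU : upward_closed U.
  move=> a j lt_ja /andP[/eqP sa Ua]; rewrite /U size_incr_nth lt_ja sa eqxx.
  have wa : positions 0 a \in words d (sumn a + d).
    rewrite /words leq_addl addnK map_f // mem_compositions sa eqxx.
    by rewrite eqxx.
  (* The last gap is included: there the bumped entry is the sentinel, and the map is the inclusion
     of [[n]] in [[n + 1]]. *)
  have wj : (nth 0%N (positions 0 a) j <= sumn a + d)%N.
    move: wa; rewrite mem_words => /and3P[/eqP sp p_sorted /eqP <-].
    rewrite -nth_last sp /=; apply: (sorted_leq_nth leq_trans leqnn) => //.
    - by apply: sub_sorted p_sorted => ? ?; apply: ltnW.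
    - by rewrite inE size_positions.
    - by rewrite inE sp.
    - by rewrite -ltnS -sa.
  rewrite positions_incr_nth // sumn_incr_nth addSn.
  exact: nonstandard_bump.
apply: (@ev_poly_eq _ _ d) (ev_poly_sub d (ev_poly_count_compositions d.+1 UU)).
move=> n le_dn; rewrite /words le_dn count_map; apply: eq_in_count => a.
rewrite mem_compositions /= /U => /andP[-> /eqP ->].
by rewrite subnK.
Qed.

Lemma exists_basis gens :
  exists b : forall n, seq (V 'I_n),
    eventually_polynomial (fun n => size (b n)) /\
    forall n, free (b n) /\
      forall v, span (b n) v <-> span (all_monomials gens n) v.
Proof.
(* The tail of the list precedes its head in the monomial order. *)
elim: gens => [|x gens [b [b_poly b_basis]]].
  exists (fun=> [::]); split; first exact: ev_poly_const.
  by move=> n; split=> // c.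
pose w n : seq (seq nat) := sort (<=%O : rel (seqlexi nat)) (words (tag x) n).
pose std n := predC (nonstandard gens x n).
exists (fun n => b n ++ map (monomial n x) (filter (std n) (w n))); split.
  apply: (@ev_poly_eq _ _ 0) (ev_polyD b_poly (ev_poly_count_standard gens x)).
  by move=> n _; rewrite size_cat size_map size_filter count_sort.
move=> n; have [b_free b_span] := b_basis n.
have w_sorted : sorted lexlt (w n).
  have -> : sorted lexlt (w n)
      = uniq (w n) && sorted <=%O (w n : seq (seqlexi nat)).
    exact: (@lt_sorted_uniq_le _ (seqlexi nat)).
  by rewrite sort_uniq words_uniq; apply/sort_sorted/le_total.
have [|f_free f_span] :=
  greedy_basis (m := monomial n x) (std := std n) (s := w n) b_free.
  move=> p1 p p2 def_w; rewrite /std /= /nonstandard /smaller_monomials.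
  have p1E : [seq q <- words (tag x) n | lexlt q p] =i p1.
    suff {1}<- : [seq q <- w n | lexlt q p] = p1.
      by move=> q; rewrite !mem_filter mem_sort.
    rewrite {1}def_w; apply: filter_lt_prefix; rewrite -?def_w //.
      exact: (@lt_trans _ (seqlexi nat)).
    exact: (@ltxx _ (seqlexi nat)).
  have mem_p1 := eq_mem_map (monomial n x) p1E.
  (* The greedy test is relative to [b n] and [nonstandard] to all monomials on [gens]; both lists
     have the same span. *)
  congr (~~ _); apply/asbool_equiv_eq; split.
    apply: span_cat => u; first by move=> /mem_span /b_span.
    by rewrite mem_p1 => /mem_span.
  apply: span_cat => u; first by move=> /mem_span /b_span.
  by rewrite -mem_p1 => /mem_span.
split=> // v; split; last first.
  move=> v_span; apply: f_span; move: v_span; rewrite /all_monomials /=.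
  apply: sub_span => u; rewrite mem_cat => /orP[/mapP[p p_word ->]|gu].
    by apply: mem_span; rewrite mem_cat map_f ?orbT ?mem_sort.
  have /b_span := mem_span gu.
  by apply: span_subset => y yb; rewrite mem_cat yb.
apply: sub_span => u; rewrite mem_cat => /orP[bu|/mapP[p]].
  have /b_span := mem_span bu.
  by apply: span_subset => y yb; rewrite mem_cat yb orbT.
rewrite mem_filter mem_sort => /andP[_ p_word] ->.
by apply: mem_span; rewrite mem_cat map_f.
Qed.

(** List the values of [F] increasingly as [r]. Then [s] sends [i] to the rank of [F i], and [F] is
    [s] followed by the increasing map with values [r]. *)
Lemma inj_hom_factor m n (v : V 'I_m) (F : inj_hom 'I_m 'I_n) :
  exists (s : inj_hom 'I_m 'I_m) (p : seq nat),
    p \in words m n /\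
    fi_map V F v = monomial n (Tagged (fun m => V 'I_m) (fi_map V s v)) p.
Proof.
pose r := sort leq [seq val (F i) | i <- enum 'I_m].
have sr : size r = m by rewrite size_sort size_map size_enum_ord.
have mem_r i : val (F i) \in r.
  by rewrite mem_sort; apply: (map_f (fun i => val (F i))); rewrite mem_enum.
have lt_rn : all (ltn^~ n) r.
  by apply/allP => j; rewrite mem_sort => /mapP[i _ ->]; apply: ltn_ord.
have r_sorted : sorted ltn r.
  rewrite ltn_sorted_uniq_leq sort_uniq map_inj_uniq ?enum_uniq.
    exact: (sort_sorted leq_total).
  by move=> i j /val_inj /inj_hom_inj.
have lt_sm i : (index (val (F i)) r < m)%N.
  by rewrite -[X in (_ < X)%N]sr index_mem.
have [|s sE] := @exists_inj_hom _ _ (fun i => Ordinal (lt_sm i)).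
  move=> i j [/(congr1 (nth 0%N r))]; rewrite (nth_index _ (mem_r i)).
  by rewrite (nth_index _ (mem_r j)) => /val_inj /inj_hom_inj.
have p_word : rcons r n \in words m n.
  rewrite mem_words size_rcons sr eqxx last_rcons eqxx andbT /=.
  rewrite (sorted_pairwise ltn_trans) pairwise_rcons lt_rn.
  by rewrite -(sorted_pairwise ltn_trans).
exists s, (rcons r n); split=> //.
have [G Gp] := word_inj_hom p_word.
rewrite (monomialE (x := Tagged (fun m => V 'I_m) (fi_map V s v)) Gp).
rewrite -fi_map_comp (_ : F = Defs.inj_comp G s) //.
apply: inj_homP => i; apply: val_inj; rewrite ffunE Gp sE /=.
by rewrite nth_rcons index_mem mem_r (nth_index _ (mem_r i)).
Qed.

(** Injections from ['I_m] to itself are permutations, so this closes the generators under the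
    symmetric groups. *)
Definition translates gens : seq element :=
  flatten [seq [seq Tagged (fun m => V 'I_m) (fi_map V s (tagged x))
               | s <- enum {: inj_hom 'I_(tag x) 'I_(tag x)}] | x <- gens].

(** A spanning list for the value at [S] of the sub-FI-module generated by [gens]. *)
Definition generated gens (S : finType) : seq (V S) :=
  flatten [seq [seq fi_map V F (tagged x) | F <- enum {: inj_hom 'I_(tag x) S}]
          | x <- gens].

Lemma generated_map gens (S T : finType) (f : inj_hom S T) (v : V S) :
  span (generated gens S) v -> span (generated gens T) (fi_map V f v).
Proof.
move: v; apply: span_linear => v /flatten_mapP[x gx /mapP[F _ ->]].
rewrite -fi_map_comp.
apply/mem_span/flatten_mapP; exists x => //.
by apply: (map_f (fun F => fi_map V F _)); rewrite mem_enum.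
Qed.

Definition generated_sub gens : sub_fi_module V :=
  @SubFIModule _ V (fun S => span (generated gens S))
    (fun S => span0 _) (fun S => @spanD _ _ _) (fun S => @spanZ _ _ _)
    (@generated_map gens).

Lemma span_translates gens n :
  (forall W : sub_fi_module V, Defs.proper_sub W ->
     ~ (forall x, x \in gens -> W 'I_(tag x) (tagged x))) ->
  forall v, span (all_monomials (translates gens) n) v.
Proof.
move=> gensP v; have : span (generated gens 'I_n) v.
  (* A vector outside the span would make [generated_sub gens] proper, although it contains every
     generator. *)
  apply: contrapT => nv; apply: (gensP (generated_sub gens)).
    by exists 'I_n, v.
  move=> x gx; apply/mem_span/flatten_mapP; exists x => //.
  apply/mapP; exists (Defs.inj_id 'I_(tag x)); first by rewrite mem_enum.
  by rewrite fi_map_id.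
apply: sub_span => u /flatten_mapP[x gx /mapP[F _ ->]].
have [s [p [p_word ->]]] := inj_hom_factor (tagged x) F.
apply/mem_span/flatten_mapP; eexists; last exact: (map_f _ p_word).
apply/flatten_mapP; exists x => //.
apply/mapP; exists s; rewrite ?mem_enum //.
Qed.

End Monomials.

Theorem theoremB (k : fieldType) (V : fi_module k)
    (V_fg : finitely_generated V) :
  exists P : {poly rat}, integer_valued P /\
    exists N : nat, forall n : nat, (N <= n)%N ->
      exists d : nat, has_dim (V 'I_n) d /\ d%:R = P.[n%:R].
Proof.
have [gens gensP] := V_fg.
have [b [[P [P_int [N bP]]] b_basis]] := exists_basis (translates gens).
exists P; split=> //; exists N => n leNn; exists (size (b n)).
have [b_free b_span] := b_basis n; split; last exact: bP.
by apply: has_dim_free => // v; apply/b_span/span_translates.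
Qed.
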